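(* For all positive integers $n,k$, $$ p_{k}(n)=\frac{B_{n}\bigl(0!\,k\,\sigma(1),\,1!\,k\,\sigma(2),\,\ldots,\,(n-1)!\,k\,\sigma(n)\bigr)}{n!}, $$ where $p_k(n)$ is the number of $k$-coloured partitions of $n$, $B_n$ is the $n$th complete Bell polynomial (evaluated with $i$th argument $(i-1)!\,k\,\sigma(i)$ for $1\le i\le n$), and $\sigma(n)=\sum_{d\mid n}d$ is the sum of the positive divisors of $n$.
   Context: A partition of a positive integer $n$ is a finite weakly decreasing sequence of positive integers (its parts) with sum $n$. A partition is $k$-coloured if each part can occur in $k$ colours; $p_k(n)$ denotes the number of $k$-coloured partitions of $n$, i.e. the number of finite multisets of pairs $(\lambda,c)$, with $\lambda$ a positive integer and $c\in\{1,\ldots,k\}$ a colour, such that the sum of the first entries (counted with multiplicity) is $n$. For example, $p_2(2)=5$, the $2$-coloured partitions of $2$ being $1+1,\ 1'+1,\ 1'+1',\ 2,\ 2'$. For non-negative integers $n,l$, the partial Bell polynomial is $$ B_{n,l}(x_1,\ldots,x_{n-l+1})=\sum \frac{n!}{\prod_{i=1}^{n-l+1}\ell_i!}\prod_{i=1}^{n-l+1}\Bigl(\frac{x_i}{i!}\Bigr)^{\ell_i}, $$ the sum running over all sequences of non-negative integers $\ell_i$ with $\sum_i i\,\ell_i=n$ and $\sum_i \ell_i=l$. In particular $B_{0,0}=1$ and $B_{n,0}=0$ for $n\ge1$. The $n$th complete Bell polynomial is $$ B_n(x_1,\ldots,x_n)=\sum_{l=0}^{n}B_{n,l}(x_1,\ldots,x_{n-l+1}).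 $$ *)

(* Defs.v *)
From mathcomp Require Import all_boot all_order all_algebra.
From mathcomp Require Import finmap multiset.
From mathcomp Require Import boolp classical_sets functions cardinality.

Set Implicit Arguments.
Unset Strict Implicit.
Unset Printing Implicit Defensive.

Import Order.TTheory GRing.Theory Num.Theory.

Local Open Scope mset_scope.
Local Open Scope ring_scope.
Local Open Scope nat_scope.

(** A pair [(i, c)] stands for a part [i] with colour [c]; the colours are the
    elements of ['I_k].  The coercion of a multiset to a sequence lists its
    elements with multiplicity. *)
Definition is_coloured_partition (k n : nat) (P : {mset nat * 'I_k}) : Prop :=
  (forall x, x \in P -> 0 < x.1) /\ \sum_(x <- P) x.1 = n.

Definition coloured_partitions (k n : nat) : set {mset nat * 'I_k} :=
  [set P | is_coloured_partition n P]%classic.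
Arguments coloured_partitions k n : clear implicits.

(** [fset_set] sends infinite sets to [fset0]; this lemma ensures that the
    cardinal taken in [coloured_partition_number] is the actual one. *)
Lemma finite_coloured_partitions (k n : nat) :
  finite_set (coloured_partitions k n).
Proof.
have bound P i c : is_coloured_partition n P ->
    (i, c) \in (P : {mset nat * 'I_k}) -> i <= n /\ P (i, c) <= n.
  case=> pos sum icP; have i0 : 0 < i := pos _ icP.
  have mi : P (i, c) * i <= n.
    rewrite -sum -(count_mem_mset (i, c) P).
    elim: (enum_mset P) => [|x s IH]; first by rewrite big_nil.
    rewrite big_cons /= mulnDl leq_add //.
    by case: (x =P (i, c)) => [->|_] //=; rewrite mul1n.
  have m0 : 0 < P (i, c) by rewrite mset_gt0.
  split; first by apply: leq_trans mi; rewrite leq_pmull.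
  by apply: leq_trans mi; rewrite leq_pmulr.
pose f (P : {mset nat * 'I_k}) : {ffun 'I_n.+1 * 'I_k -> 'I_n.+1} :=
  [ffun x : 'I_n.+1 * 'I_k => inord (P (x.1 : nat, x.2))].
have f_inj : {in coloured_partitions k n &, injective f}.
  move=> P Q /set_mem hP /set_mem hQ fPQ; apply/msetP => -[i c].
  have leP R : is_coloured_partition n R -> R (i, c) <= n.
    move=> hR; case: (boolP ((i, c) \in R)) => [/(bound _ _ _ hR)[]//|].
    by rewrite -mset_eq0 => /eqP ->.
  case: (leqP i n) => [le_in|lt_ni].
    have /(congr1 val) := (iffRL (ffunP _ _) fPQ) (inord i, c).
    by rewrite !ffunE /= !inordK // ltnS leP.
  have out R : is_coloured_partition n R -> R (i, c) = 0.
    move=> hR; apply/mset_eq0P/negP => /(bound _ _ _ hR)[].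
    by rewrite leqNgt lt_ni.
  by rewrite !out.
by rewrite -(eq_finite_set (inj_card_eq f_inj)); exact: finite_finset.
Qed.

Definition coloured_partition_number (k n : nat) : nat :=
  #|` fset_set (coloured_partitions k n)|%fset.

(** The [j]th coordinate ([j] counted from 0) of [e] is the exponent
    [ell_(j+1)]; being at most [n], the exponents range over ['I_n.+1].
    Only the values [x 1, ..., x (n - l + 1)] of the sequence [x] are used,
    and [n.+1 - l] is [n - l + 1] when [l <= n]. *)
Definition is_bell_index (n l : nat) (e : {ffun 'I_(n.+1 - l) -> 'I_n.+1}) :=
  (\sum_(j < n.+1 - l) j.+1 * e j == n) && (\sum_(j < n.+1 - l) e j == l).

Definition partial_bell (F : numFieldType) (n l : nat) (x : nat -> F) : F :=
  (\sum_(e : {ffun 'I_(n.+1 - l) -> 'I_n.+1} | is_bell_index e)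
     (n`!%:R / \prod_(j < n.+1 - l) (e j)`!%:R *
      \prod_(j < n.+1 - l) (x j.+1 / j.+1`!%:R) ^+ e j))%R.

Definition complete_bell (F : numFieldType) (n : nat) (x : nat -> F) : F :=
  (\sum_(0 <= l < n.+1) partial_bell n l x)%R.

Definition sigma (n : nat) : nat := \sum_(d <- divisors n) d.

(* Main.v *)
Require Import Defs.
From mathcomp Require Import all_boot all_order all_algebra.
From mathcomp Require Import finmap multiset.
From mathcomp Require Import classical_sets cardinality.
From mathcomp Require Import ring.

(** Both sides are the coefficient of [X^n] in the same power series, because
    their generating functions have the same logarithmic derivative and the
    same constant term:

    - coloured partitions are counted by the product over the parts [i] and the
      colours [c] of [1 / (1 - X^i)], and the operator [P |-> X P' / P] turns
      each factor into [i (X^i + X^(2i) + ...)]; collecting these over all [i]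
      and [c], the coefficient of [X^m] is [k] times the sum of the divisors
      of [m];
    - [complete_bell n x / n!] is the coefficient of [X^n] in the exponential
      of the sum of the [x_j X^j / j!], that is in the product of the
      [exp (x_j X^j / j!)]; here [P |-> X P' / P] gives the sum of the
      [x_j X^j / (j-1)!], which for [x_j = (j-1)! k sigma(j)] is the sum of the
      [k sigma(j) X^j].

    Power series are replaced by polynomials modulo [X^(n+1)].  The generating
    functions become instances of one finite product, [weighted_product], whose
    coefficients are sums over exponent functions
    ([coef_weighted_product]); [coloured_partition_numberE] and
    [complete_bellE] identify the two sides with such coefficients.  The
    relation [X P' = H P] modulo [X^N] is [logderiv_mod]; it passes to products
    ([logderiv_mod_prod]) and to substitutions of [X^w] for [X]
    ([logderiv_mod_compXn]), so that it needs to be checked only for the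
    geometric and the exponential series.  In characteristic zero it
    determines the coefficients of [P] from those of [H] and from the constant
    term ([coef_eq_of_logderiv_mod]). *)

Set Implicit Arguments.
Unset Strict Implicit.
Unset Printing Implicit Defensive.

Import Order.TTheory GRing.Theory Num.Theory.

Local Open Scope mset_scope.
Local Open Scope ring_scope.

(** * Logarithmic derivatives of truncated power series *)

Lemma dvdXnP (F : fieldType) (N : nat) (p : {poly F}) :
  reflect (forall i, (i < N)%N -> p`_i = 0) ('X^N %| p).
Proof.
apply: (iffP idP) => [/dvdpP[q ->] i iN|p0]; first by rewrite coefMXn iN.
rewrite -(poly_take_drop N p) dvdp_addl ?dvdp_mull ?dvdpp //.
suff -> : take_poly N p = 0 by rewrite dvdp0.
by apply/polyP => i; rewrite coef_take_poly coef0; case: ifP => // /p0.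
Qed.

(** [H] is the logarithmic derivative [X P' / P] modulo [X^N].  The relation is
    kept multiplicative so that no inverse of [P] has to be formed, and carries
    the factor [X] so that substituting [X^w] for [X] only rescales [H]. *)
Definition logderiv_mod (F : fieldType) (N : nat) (P H : {poly F}) : bool :=
  'X^N %| 'X * P^`() - H * P.

(** Comparing coefficients of [X^i] turns the differential relation into the
    convolution recurrence for the coefficients of [P]. *)
Lemma logderiv_mod_coef (F : fieldType) (N : nat) (P H : {poly F}) :
  reflect (forall i, (i < N)%N ->
             P`_i *+ i = \sum_(j < i.+1) H`_j * P`_(i - j))
          (logderiv_mod N P H).
Proof.
have XP' i : ('X * P^`())`_i = P`_i *+ i.
  by rewrite coefXM; case: i => [|i]; rewrite ?mulr0n //= coef_deriv.
apply: (iffP (dvdXnP _ _)) => E i /E.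
  by rewrite coefB XP' coefM => /eqP; rewrite subr_eq0 => /eqP.
by rewrite coefB XP' coefM => ->; rewrite subrr.
Qed.

Lemma logderiv_modM (F : fieldType) (N : nat) (P Q H K : {poly F}) :
  logderiv_mod N P H -> logderiv_mod N Q K -> logderiv_mod N (P * Q) (H + K).
Proof.
move=> dP dQ; rewrite /logderiv_mod derivM.
have -> : 'X * (P^`() * Q + P * Q^`()) - (H + K) * (P * Q) =
    ('X * P^`() - H * P) * Q + P * ('X * Q^`() - K * Q) by ring.
by apply: dvdp_add; [apply: dvdp_mulr | apply: dvdp_mull].
Qed.

Lemma logderiv_mod_prod (F : fieldType) (N : nat) (I : finType)
    (P H : I -> {poly F}) :
  (forall i, logderiv_mod N (P i) (H i)) ->
  logderiv_mod N (\prod_i P i) (\sum_i H i).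
Proof.
move=> PH; elim/big_ind2: _ => [|HA A HB B|i _]; last exact: PH.
  by rewrite /logderiv_mod derivC mulr0 mul0r subrr dvdp0.
exact: logderiv_modM.
Qed.

(** By the chain rule [X (P(X^w))' = w X^w P'(X^w)], which is [w] times
    [X P'] taken at [X^w]; and multiples of [X^N] become multiples of
    [X^(w N)]. *)
Lemma logderiv_mod_compXn (F : fieldType) (N w : nat) (P H : {poly F}) :
  (0 < w)%N -> logderiv_mod N P H ->
  logderiv_mod N (P \Po 'X^w) (w%:R *: (H \Po 'X^w)).
Proof.
move=> w0 /(dvdp_comp_poly 'X^w); rewrite comp_Xn_poly -exprM => dvd.
rewrite /logderiv_mod deriv_comp derivXn.
have -> : 'X * ((P^`() \Po 'X^w) * ('X^(w.-1) *+ w))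
    - w%:R *: (H \Po 'X^w) * (P \Po 'X^w)
    = w%:R *: (('X * P^`() - H * P) \Po 'X^w).
  rewrite comp_polyB !comp_polyM comp_polyX scalerBr -scalerAl -scaler_nat.
  rewrite -scalerAr -scalerAr mulrCA -exprS prednK //.
  by rewrite [in RHS]mulrC.
rewrite -[X in _ %| X]mul_polyC; apply: dvdp_mull; apply: dvdp_trans dvd.
by rewrite dvdp_exp2l // leq_pmull.
Qed.

(** As [H] has no constant term, the recurrence expresses [i] times the [i]th
    coefficient of [P] through earlier ones, and [i] can be divided out in
    characteristic zero. *)
Lemma coef_eq_of_logderiv_mod (F : numFieldType) (N : nat)
    (P Q H K : {poly F}) :
  logderiv_mod N P H -> logderiv_mod N Q K ->
  H`_0 = 0 -> (forall i, (i < N)%N -> H`_i = K`_i) -> P`_0 = Q`_0 ->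
  forall i, (i < N)%N -> P`_i = Q`_i.
Proof.
move=> /logderiv_mod_coef dP /logderiv_mod_coef dQ H0 HK PQ0.
elim/ltn_ind => -[//|i] IH iN.
suff: P`_i.+1 *+ i.+1 = Q`_i.+1 *+ i.+1.
  by move/eqP; rewrite eqrMn2r //= => /eqP.
rewrite dP // dQ //; apply: eq_bigr => -[[|j] /= ji] _.
  by rewrite -HK ?H0 ?mul0r // (ltn_trans _ iN).
have jN : (j.+1 < N)%N by apply: leq_ltn_trans iN.
have ij : (i.+1 - j.+1 < i.+1)%N by rewrite subSS ltnS leq_subr.
by rewrite HK // IH // (ltn_trans ij) // ltnW.
Qed.

(** [X P' / P = X / (1 - X) = X + X^2 + ...] for [P = 1 / (1 - X)]. *)
Lemma logderiv_mod_geometric (F : fieldType) (N : nat) :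
  logderiv_mod N (\poly_(e < N) (1 : F)) (\poly_(e < N) (0 < e)%N%:R).
Proof.
apply/logderiv_mod_coef => i iN; rewrite coef_poly iN.
rewrite big_ord_recl coef_poly (leq_trans _ iN) // mul0r add0r.
rewrite (eq_bigr (fun=> 1)) ?sumr_const ?card_ord // => j _.
rewrite !coef_poly /= /bump /= add1n (leq_ltn_trans (leq_subr _ _)) // mulr1.
by rewrite (leq_trans _ iN) // ltnS ltn_ord.
Qed.

(** [X P' / P = y X] for [P = exp (y X)]. *)
Lemma logderiv_mod_exponential (F : numFieldType) (N : nat) (y : F) :
  logderiv_mod N (\poly_(e < N) (y ^+ e / e`!%:R)) (y *: 'X).
Proof.
apply/logderiv_mod_coef => -[|i] iN.
  by rewrite big_ord1 coefZ coefX !mulr0 mul0r.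
rewrite !big_ord_recl big1 => [|j _]; last by rewrite coefZ coefX mulr0 mul0r.
rewrite !coefZ !coefX /= !mulr0 mul0r add0r addr0 mulr1 subSS subn0.
rewrite !coef_poly iN (ltnW iN) factS natrM exprS -mulr_natr.
have := pnatr_eq0 F i.+1; have := pnatr_eq0 F i`!; rewrite eqn0Ngt fact_gt0 /=.
move=> /negbT i0 /negbT; rewrite -natr1 addrC => s0; by field; rewrite i0.
Qed.

(** * Products of series in powers of the variable *)

Section WeightedProduct.
Variables (F : fieldType) (T : finType) (N : nat).
Variables (w : T -> nat) (g : T -> nat -> F).

Definition weighted_product : {poly F} :=
  \prod_t ((\poly_(e < N) g t e) \Po 'X^(w t)).

(** Expanding the product by distributivity, each choice [f] of a term in every
    factor contributes one monomial, of degree the weighted sum of [f]. *)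
Lemma coef_weighted_product (n : nat) :
  weighted_product`_n =
  \sum_(f : {ffun T -> 'I_N} | (\sum_t w t * f t)%N == n) \prod_t g t (f t).
Proof.
rewrite /weighted_product.
under eq_bigr => t _.
  rewrite poly_def linear_sum /=.
  under eq_bigr => e _ do rewrite linearZ /= comp_Xn_poly -exprM.
  over.
rewrite bigA_distr_bigA coef_sum [RHS]big_mkcond; apply: eq_bigr => f _.
rewrite scaler_prod prodrXr coefZ coefXn eq_sym.
by case: ifP => _; rewrite ?mulr1 ?mulr0.
Qed.

Lemma weighted_product0 :
  (0 < N)%N -> (forall t, 0 < w t)%N -> (forall t, g t 0%N = 1) ->
  weighted_product`_0 = 1.
Proof.
move=> N0 w0 g0; rewrite -horner_coef0 horner_prod big1 // => t _.
by rewrite horner_comp hornerXn expr0n gtn_eqF //= horner_coef0 coef_poly N0.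
Qed.

Definition weighted_logderiv (H : T -> {poly F}) : {poly F} :=
  \sum_t (w t)%:R *: (H t \Po 'X^(w t)).

Lemma logderiv_mod_weighted_product (H : T -> {poly F}) :
  (forall t, 0 < w t)%N ->
  (forall t, logderiv_mod N (\poly_(e < N) g t e) (H t)) ->
  logderiv_mod N weighted_product (weighted_logderiv H).
Proof.
by move=> w0 dH; apply: logderiv_mod_prod => t; apply: logderiv_mod_compXn.
Qed.

Lemma weighted_logderiv0 (H : T -> {poly F}) :
  (forall t, 0 < w t)%N -> (forall t, (H t)`_0 = 0) ->
  (weighted_logderiv H)`_0 = 0.
Proof.
move=> w0 H0; rewrite coef_sum big1 // => t _.
by rewrite coefZ coef_comp_poly_Xn // dvdn0 div0n H0 mulr0.
Qed.
End WeightedProduct.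

(** * The complete Bell polynomial as a coefficient *)

(** In the [l]th partial Bell polynomial the exponents are indexed by
    ['I_(n.+1 - l)], which varies with [l]; extending them by zero to
    ['I_n.+1], the case [l = 0], places the indices for all [l] in one type. *)
Section ZeroExtension.
Variables (m N d : nat) (le_mN : (m <= N)%N).

Definition zero_extension (e : {ffun 'I_m -> 'I_d.+1}) :
    {ffun 'I_N -> 'I_d.+1} :=
  [ffun j : 'I_N => oapp e ord0 (insub (j : nat))].

Definition restriction (f : {ffun 'I_N -> 'I_d.+1}) : {ffun 'I_m -> 'I_d.+1} :=
  [ffun j => f (widen_ord le_mN j)].

Lemma zero_extension_widen e j : zero_extension e (widen_ord le_mN j) = e j.
Proof. by rewrite ffunE (valK j). Qed.

Lemma restrictionK e : restriction (zero_extension e) = e.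
Proof. by apply/ffunP => j; rewrite ffunE zero_extension_widen. Qed.

Lemma zero_extensionK (f : {ffun 'I_N -> 'I_d.+1}) :
  (forall j : 'I_N, (m <= j)%N -> f j = ord0) ->
  zero_extension (restriction f) = f.
Proof.
move=> f0; apply/ffunP => j; rewrite ffunE.
case: insubP => [j' _ jj'|]; last by rewrite -leqNgt => /f0 ->.
by rewrite /= ffunE; congr (f _); apply: val_inj.
Qed.

Lemma big_zero_extension (R : Type) (idx : R) (op : Monoid.com_law idx)
    (F : nat -> nat -> R) e :
  (forall j, F j 0%N = idx) ->
  \big[op/idx]_(j < N) F j (zero_extension e j) =
  \big[op/idx]_(j < m) F j (e j).
Proof.
move=> F0; rewrite (bigID (fun j : 'I_N => (j < m)%N)) /=.
rewrite [X in op _ X]big1 => [|j /negbTE jm].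
  rewrite Monoid.mulm1 big_ord_narrow; apply: eq_bigr => j _.
  by rewrite zero_extension_widen.
by rewrite ffunE insubF.
Qed.
End ZeroExtension.

(** Subtracting the two conditions on [f] gives [\sum_j j * f j = n - l], which
    leaves no room for a nonzero [f j] with [j > n - l]; hence every such [f] is
    the extension by zero of an index of the [l]th partial Bell polynomial. *)
Lemma partial_bellE (F : numFieldType) (n l : nat) (x : nat -> F) :
  (l <= n)%N ->
  partial_bell n l x / n`!%:R =
  \sum_(f : {ffun 'I_n.+1 -> 'I_n.+1} |
          (\sum_(j < n.+1) j.+1 * f j == n)%N &&
          (\sum_(j < n.+1) f j == l)%N)
     \prod_(j < n.+1) ((x j.+1 / j.+1`!%:R) ^+ f j / (f j)`!%:R).
Proof.
move=> ln; have leN : (n.+1 - l <= n.+1)%N by rewrite leq_subr.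
rewrite (reindex_onto (@zero_extension _ n.+1 n) (restriction leN)) /=.
  rewrite /partial_bell mulr_suml; apply: eq_big => e.
    rewrite restrictionK eqxx andbT /is_bell_index.
    rewrite (big_zero_extension leN _ (F := fun j a => (j.+1 * a)%N)) => [|j].
      by rewrite (big_zero_extension leN _ (F := fun _ a => a)).
    by rewrite muln0.
  move=> _; rewrite (big_zero_extension leN _
    (F := fun j a => (x j.+1 / j.+1`!%:R) ^+ a / a`!%:R)).
    rewrite big_split /= prodfV mulrC !mulrA mulVf ?pnatr_eq0 -?lt0n ?fact_gt0 //.
    by rewrite mul1r mulrC.
  by move=> j; rewrite divr1.
move=> f /andP[/eqP sum_jf /eqP sum_f]; apply: zero_extensionK => j.
apply: contraTeq => fj0; rewrite -ltnNge subSn // ltnS.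
have -> : (n - l = \sum_(i < n.+1) i * f i)%N.
  rewrite -[X in (X - _)%N]sum_jf -sum_f.
  by under eq_bigr do rewrite mulSn; rewrite big_split addKn.
by rewrite (bigD1 j) //= (leq_trans _ (leq_addr _ _)) // leq_pmulr // lt0n.
Qed.

(** Grouping the exponent functions of weighted sum [n] by their sum [l], which
    is at most [n], recovers the partial Bell polynomials. *)
Lemma complete_bellE (F : numFieldType) (n : nat) (x : nat -> F) :
  complete_bell n x / n`!%:R =
  (weighted_product n.+1 (fun j : 'I_n.+1 => j.+1)
    (fun j e => (x j.+1 / j.+1`!%:R) ^+ e / e`!%:R))`_n.
Proof.
rewrite coef_weighted_product /complete_bell mulr_suml big_mkord.
pose parts (f : {ffun 'I_n.+1 -> 'I_n.+1}) := (\sum_j f j)%N.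
rewrite [RHS](partition_big (fun f => inord (parts f) : 'I_n.+1) xpredT) //=.
apply: eq_bigr => l _; rewrite partial_bellE -1?ltnS //.
apply: eq_bigl => f; case: eqP => //= sum_jf; rewrite -val_eqE /= inordK //.
by rewrite ltnS -sum_jf; apply: leq_sum => j _; rewrite leq_pmull.
Qed.

(** * The number of coloured partitions as a coefficient *)

Lemma coloured_partition_bound (k n : nat) (P : {mset nat * 'I_k}) i c :
  is_coloured_partition n P -> (P (i, c) * i <= n)%N.
Proof.
case=> _ <-; rewrite -(count_mem_mset (i, c) P).
elim: (enum_mset P) => [|y s IH]; first by rewrite big_nil.
rewrite big_cons /= mulnDl leq_add //.
by case: (y =P (i, c)) => [->|_] //=; rewrite mul1n.
Qed.

(** An exponent function [f] stands for the coloured partition in which the part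
    [i.+1] with colour [c] has multiplicity [f (i, c)]. *)
Section Multiplicities.
Variables (n k : nat).
Implicit Type f : {ffun 'I_n.+1 * 'I_k -> 'I_n.+1}.

Definition part_seq f : seq (nat * 'I_k) :=
  flatten [seq nseq (f t) (t.1.+1, t.2) | t <- index_enum _].

Definition mset_of_multiplicities f : {mset nat * 'I_k} :=
  seq_mset (part_seq f).

Lemma mem_part_seq f x : x \in part_seq f -> (0 < x.1 <= n.+1)%N.
Proof. by case/flattenP=> s /mapP[t _ ->] /nseqP[-> _] /=. Qed.

Lemma mset_of_multiplicitiesE f (t : 'I_n.+1 * 'I_k) :
  mset_of_multiplicities f (t.1.+1, t.2) = f t.
Proof.
rewrite mset_seqE count_flatten sumnE !big_map (bigD1 t) //= big1 => [|u ut].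
  by rewrite count_nseq /= eqxx mul1n addn0.
rewrite count_nseq /=; case: eqP => // -[/val_inj u1 u2].
by case/eqP: ut; rewrite [u]surjective_pairing u1 u2 -surjective_pairing.
Qed.

Lemma sum_mset_of_multiplicities f :
  (\sum_(x <- mset_of_multiplicities f) x.1 =
   \sum_(t : 'I_n.+1 * 'I_k) t.1.+1 * f t)%N.
Proof.
rewrite (perm_big _ (perm_eq_seq_mset _)) big_flatten big_map.
by apply: eq_bigr => t _; rewrite big_nseq iter_addn_0.
Qed.

(** Multiplicities and parts of a coloured partition of [n] are at most [n], so
    it is recovered from finitely many bounded multiplicities. *)
Lemma mset_of_multiplicities_surj (P : {mset nat * 'I_k}) :
  is_coloured_partition n P ->
  P = mset_of_multiplicities
        [ffun t : 'I_n.+1 * 'I_k => inord (P (t.1.+1, t.2))].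
Proof.
move=> hP; apply/msetP => -[i c]; set f := finfun _.
have bound := coloured_partition_bound i c hP.
have [/andP[i0 iN]|out] := boolP (0 < i <= n.+1)%N.
  have lt_iN : (i.-1 < n.+1)%N by rewrite prednK.
  have := mset_of_multiplicitiesE f (Ordinal lt_iN, c).
  rewrite /= ffunE /= prednK // => ->; rewrite inordK // ltnS.
  by apply: leq_trans bound; rewrite leq_pmulr.
have -> : mset_of_multiplicities f (i, c) = 0%N.
  by rewrite mset_seqE; apply/count_memPn; apply: contra out => /mem_part_seq.
apply/mset_eq0P; apply: contra out => Pic.
have /= i0 := hP.1 _ Pic; rewrite i0 /= leqW //.
by apply: leq_trans bound; rewrite leq_pmull // mset_gt0.
Qed.
End Multiplicities.

(** The factor at [(i, c)] is the truncated geometric series in [X^i.+1], whose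
    term of exponent [e] records the multiplicity [e] of the part [i.+1] with
    colour [c]. *)
Lemma coloured_partition_numberE (k n : nat) :
  (coloured_partition_number k n)%:R =
  (weighted_product n.+1 (fun t : 'I_n.+1 * 'I_k => t.1.+1)
    (fun _ _ => 1 : rat))`_n.
Proof.
rewrite coef_weighted_product.
rewrite [RHS](eq_bigr (fun=> 1)) => [|f _]; last by rewrite big1.
rewrite sumr_const; congr (_%:R).
rewrite /coloured_partition_number cardE.
rewrite -(size_map (@mset_of_multiplicities n k)).
apply: perm_size; apply: uniq_perm; first exact: fset_uniq.
  rewrite map_inj_uniq ?enum_uniq // => f f' ff'.
  apply/ffunP => t; apply: val_inj.
  by rewrite /= -!mset_of_multiplicitiesE ff'.
move=> P; rewrite in_fset_set; last exact: finite_coloured_partitions.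
apply/idP/mapP => [/set_mem hP|[f]].
  have := mset_of_multiplicities_surj hP; set f := finfun _ => Pf.
  exists f => //; rewrite mem_enum unfold_in -sum_mset_of_multiplicities -Pf.
  by apply/eqP; exact: hP.2.
rewrite mem_enum unfold_in => /eqP sum_f ->; apply/mem_set; split.
  by move=> x; rewrite (perm_mem (perm_eq_seq_mset _)) => /mem_part_seq/andP[].
by rewrite sum_mset_of_multiplicities.
Qed.

(** * Comparison of the logarithmic derivatives *)

Lemma sigma_ord (N m : nat) : (0 < m < N)%N ->
  sigma m = (\sum_(i < N | i.+1 %| m) i.+1)%N.
Proof.
move=> /andP[m0 mN].
rewrite -(big_mkord (fun i => (i.+1 %| m)%N) succn).
rewrite -(big_add1 _ _ 0 N.+1 (fun d => (d %| m)%N) id) -big_filter /sigma.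
apply/perm_big/uniq_perm; rewrite ?divisors_uniq ?filter_uniq ?iota_uniq //.
move=> d.
rewrite -dvdn_divisors // mem_filter mem_index_iota.
by case: (boolP (d %| m)%N) => //= dm;
  rewrite (dvdn_gt0 m0 dm) ltnS ltnW // (leq_ltn_trans _ mN) // dvdn_leq.
Qed.

(** The part [i.+1] contributes [i.+1] times the sum of the powers
    [X^(i.+1 e)] with [e > 0], so that [X^m] collects every divisor of [m], once
    for each colour. *)
Lemma coef_partition_logderiv (F : fieldType) (n k m : nat) :
  (0 < m < n.+1)%N ->
  (weighted_logderiv (fun t : 'I_n.+1 * 'I_k => t.1.+1)
     (fun _ => \poly_(e < n.+1) (0 < e)%N%:R : {poly F}))`_m =
  k%:R * (sigma m)%:R.
Proof.
move=> m0N; have /andP[m0 mN] := m0N; rewrite coef_sum.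
rewrite -(pair_big xpredT xpredT (fun (i : 'I_n.+1) (_ : 'I_k) =>
  (i.+1%:R *: ((\poly_(e < n.+1) (0 < e)%N%:R) \Po 'X^(i.+1)) : {poly F})`_m)).
under eq_bigr => i _.
  rewrite sumr_const card_ord coefZ coef_comp_poly_Xn // coef_poly.
  over.
rewrite (sigma_ord m0N) natr_sum mulr_sumr [RHS]big_mkcond.
apply: eq_bigr => i _; case: ifP => im; last by rewrite mulr0 mul0rn.
rewrite (leq_ltn_trans (leq_div _ _) mN) divn_gt0 // dvdn_leq //.
by rewrite mulr1 mulr_natl.
Qed.

Lemma coef_bell_logderiv (F : numFieldType) (n m : nat) (x : nat -> F) :
  (m < n.+1)%N ->
  (weighted_logderiv (fun j : 'I_n.+1 => j.+1)
     (fun j => (x j.+1 / j.+1`!%:R) *: 'X))`_m.+1 = x m.+1 / m`!%:R.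
Proof.
move=> mN; rewrite coef_sum (bigD1 (Ordinal mN)) //= big1 => [|j jm].
  rewrite comp_polyZ comp_polyX !coefZ coefXn eqxx mulr1 addr0 factS natrM.
  by rewrite mulrCA invfM mulVKf ?pnatr_eq0.
rewrite comp_polyZ comp_polyX !coefZ coefXn eqSS eq_sym.
by rewrite -[m]/(val (Ordinal mN)) val_eqE (negbTE jm) !mulr0.
Qed.

Theorem theorem2 (n k : nat) (hn : (0 < n)%N) (hk : (0 < k)%N) :
  ((coloured_partition_number k n)%:R =
   complete_bell n (fun i : nat => (i.-1)`!%:R * k%:R * (sigma i)%:R)
     / n`!%:R :> rat)%R.
Proof.
rewrite coloured_partition_numberE complete_bellE.
pose x (i : nat) : rat := (i.-1)`!%:R * k%:R * (sigma i)%:R.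
have dL := logderiv_mod_weighted_product
  (fun t : 'I_n.+1 * 'I_k => ltn0Sn t.1)
  (fun _ => logderiv_mod_geometric rat n.+1).
have dR := logderiv_mod_weighted_product
  (fun j : 'I_n.+1 => ltn0Sn j)
  (fun j => logderiv_mod_exponential n.+1 (x j.+1 / j.+1`!%:R)).
have HL0 : (weighted_logderiv (fun t : 'I_n.+1 * 'I_k => t.1.+1)
    (fun _ => \poly_(e < n.+1) (0 < e)%N%:R : {poly rat}))`_0 = 0.
  by rewrite weighted_logderiv0 // => t; rewrite coef_poly.
apply: (coef_eq_of_logderiv_mod dL dR) => //.
- move=> [|m] mN.
    by rewrite HL0 weighted_logderiv0 // => j; rewrite coefZ coefX mulr0.
  rewrite coef_partition_logderiv // (coef_bell_logderiv x) ?(ltnW mN) // /x /=.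
  by field; rewrite pnatr_eq0 -lt0n fact_gt0.
- by rewrite !weighted_product0 // => j; rewrite expr0 divr1.
Qed.
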